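(* Let $L=\bigcup_{i=1}^m L_i\subset\mathbb R^k$ be a linear network, where $L_i$ is the closed line segment with (ordered) endpoints $a_i,b_i$ and length $l_i>0$, let $V$ be its vertex set, let $u_0\in V$ be the chosen origin, let $\Sigma=\Delta^{-1}$ be the associated covariance matrix indexed by $V$, let $d_V$ be the resistance metric on $V$, and let $d_{\mathcal R}$ be the resistance metric on $L$ (all defined in the context). For any $i,j\in\{1,\ldots,m\}$ and any $u\in L_j$, $v\in L_i$, let $$s=\|u-a_j\|,\qquad t=\|v-a_i\|,\qquad A_i=\frac{d_V(a_i,b_i)}{l_i^2}-\frac1{l_i}.$$ Then $A_i\le 0$, with equality if and only if $L_i$ is the only path connecting $a_i$ and $b_i$. Moreover: (A) If $i=j$, then $$d_{\mathcal R}(u,v)=\begin{cases}A_i(t-s)^2+t-s & \text{if } t\ge s,\\ A_i(s-t)^2+s-t & \text{if } t\le s,\end{cases}$$ so $d_{\mathcal R}(u,v)$ considered as a function of $t$ is linear (in the case $A_i=0$) or quadratic (in the case $A_i<0$) on each of the intervals $[0,s]$ and $[s,l_i]$, continuous on $[0,l_i]$, and differentiable on $[0,l_i]\setminus\{s\}$. (B) If $i\ne j$, then $$d_{\mathcal R}(u,v)=A_it^2+B_{ij}(s)t+C_{ij}(s),$$ where $$B_{ij}(s)=1-\frac{2}{l_i}\Big[\Sigma(a_i,a_i)-\Sigma(a_i,b_i)-\frac{l_j-s}{l_j}\Sigma(a_j,a_i)+\frac{l_j-s}{l_j}\Sigma(a_j,b_i)-\frac{s}{l_j}\Sigma(b_j,a_i)+\frac{s}{l_j}\Sigma(b_j,b_i)\Big]$$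 and $$C_{ij}(s)=\frac{(l_j-s)^2}{l_j^2}\Sigma(a_j,a_j)+\frac{s^2}{l_j^2}\Sigma(b_j,b_j)+2\frac{s(l_j-s)}{l_j^2}\Sigma(a_j,b_j)+\Sigma(a_i,a_i)-2\frac{l_j-s}{l_j}\Sigma(a_j,a_i)-2\frac{s}{l_j}\Sigma(b_j,a_i)+\frac{s(l_j-s)}{l_j},$$ so $d_{\mathcal R}(u,v)$ is a linear or quadratic concave function of $t\in[0,l_i]$. (C) If $i\ne j$, then $$d_{\mathcal R}(u,v)\ge\min\{d_{\mathcal R}(u,a_i),d_{\mathcal R}(u,b_i)\}.$$
   Context: Linear network: $L=\bigcup_{i=1}^m L_i$ with $m<\infty$, where each $L_i\subset\mathbb R^k$ is a closed line segment of length $l_i\in(0,\infty)$ with endpoints $a_i,b_i$ (an ordering of the endpoints is fixed), $L_i\cap L_j$ is either empty or an endpoint of both $L_i$ and $L_j$ whenever $i\neq j$, and $L$ is path-connected. $\|\cdot\|$ is the Euclidean norm. Graph: $V$ is the set of endpoints of $L_1,\ldots,L_m$; for distinct $u,v\in V$ write $u\sim v$ if and only if $\{u,v\}=\{a_j,b_j\}$ for some $j$. A path connecting two distinct vertices $a,b\in V$ is a subset of $L$ of the form $[p_0,p_1]\cup[p_1,p_2]\cup\cdots\cup[p_{n-1},p_n]$ with $n\ge1$, $p_0=a$, $p_n=b$, where $p_0,\ldots,p_n\in V$ are pairwise distinct and $p_{r-1}\sim p_r$ for $r=1,\ldots,n$; here $[p,q]$ is the closed line segment between $p$ and $q$. Resistance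 metric on $V$: fix an arbitrary $u_0\in V$ (the origin). For $u,v\in V$ let $\mathrm{con}(u,v)=1/\|u-v\|$ if $u\sim v$ and $\mathrm{con}(u,v)=0$ otherwise, and let $c(u)=\sum_{w\in V:\,w\sim u}\mathrm{con}(u,w)$. Let $\Delta$ be the matrix indexed by $V\times V$ with $\Delta(u,u)=1+c(u)$ if $u=u_0$, $\Delta(u,u)=c(u)$ if $u\ne u_0$, and $\Delta(u,v)=-\mathrm{con}(u,v)$ if $u\neq v$. The matrix $\Delta$ is symmetric and strictly positive definite; put $\Sigma=\Delta^{-1}$. Let $B_0$ be a zero mean Gaussian vector indexed by $V$ with covariance matrix $\Sigma$. Define $d_V(u,v)=\mathrm{Var}(B_0(u)-B_0(v))=\Sigma(u,u)+\Sigma(v,v)-2\Sigma(u,v)$ for $u,v\in V$. Resistance metric on $L$: extend $B_0$ linearly to $L$ by $Z_0(u)=\frac{\|u-b_i\|}{l_i}B_0(a_i)+\frac{\|u-a_i\|}{l_i}B_0(b_i)$ for $u\in L_i$. For $i=1,\ldots,m$ let $B_i$ be a zero mean Brownian bridge on $L_i$, i.e. a zero mean Gaussian process with $\mathrm{Cov}(B_i(u),B_i(v))=\min\{\|u-a_i\|\|v-b_i\|,\|v-a_i\|\|u-b_i\|\}/l_i$ for $u,v\in L_i$, and let $Z_i(u)=B_i(u)$ for $u\in L_i$ and $Z_i(u)=0$ for $u\in L\setminus L_i$. Then $$d_{\mathcal R}(u,v)=\sum_{i=0}^m\mathrm{Var}(Z_i(u)-Z_i(v)),\qquad u,v\in L.$$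 *)

(* Defs.v *)
From HB Require Import structures.
From mathcomp Require Import all_boot all_order all_algebra finmap.
From mathcomp Require Import all_classical all_reals all_analysis.

Set Implicit Arguments.
Unset Strict Implicit.
Unset Printing Implicit Defensive.

Import Order.TTheory GRing.Theory Num.Theory.
Import numFieldNormedType.Exports.

Local Open Scope classical_set_scope.
Local Open Scope ring_scope.

Section Geometry.
Context {R : realType} {k : nat}.
Implicit Types (x y : 'rV[R]_k) (A : set 'rV[R]_k).

(* The library norm on 'rV[R]_k is the sup norm. *)
Definition enorm x : R := Num.sqrt (\sum_(r < k) x 0 r ^+ 2).

Definition segment x y : set 'rV[R]_k :=
  [set z | exists2 t : R, 0 <= t <= 1 & z = (1 - t) *: x + t *: y].

Definition path_connected A : Prop :=
  forall x y, A x -> A y -> exists g : R -> 'rV[R]_k,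
    [/\ {within `[0, 1], continuous g}, g 0 = x, g 1 = y
      & g @` `[0, 1] `<=` A].

End Geometry.

Record linear_network (R : realType) (k : nat) := LinearNetwork {
  nseg : nat;
  src : 'I_nseg -> 'rV[R]_k;
  tgt : 'I_nseg -> 'rV[R]_k;
  src_neq_tgt : forall i, src i != tgt i;
  segments_meet : forall i j, i != j ->
    segment (src i) (tgt i) `&` segment (src j) (tgt j) = set0 \/
    exists p, [/\ segment (src i) (tgt i) `&` segment (src j) (tgt j) = [set p],
                  p = src i \/ p = tgt i & p = src j \/ p = tgt j];
  network_connected :
    path_connected (\bigcup_(i : 'I_nseg) segment (src i) (tgt i))
}.

Section Network.
Context {R : realType} {k : nat} (N : linear_network R k).
Local Notation point := 'rV[R]_k.
Local Notation m := (nseg N).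

Definition seg (i : 'I_m) : set point := segment (src i) (tgt i).

Definition network : set point := \bigcup_(i : 'I_m) seg i.

Definition len (i : 'I_m) : R := enorm (src i - tgt i).

(* For 0 <= t <= len i, the point of seg i at distance t from src i. *)
Definition seg_point (i : 'I_m) (t : R) : point :=
  src i + (t / len i) *: (tgt i - src i).

Definition vertices : {fset point} :=
  [fset x in codom (@src R k N) ++ codom (@tgt R k N)]%fset.

Lemma src_vertices (i : 'I_m) : src i \in vertices.
Proof. by rewrite !inE /= codom_f. Qed.

Lemma tgt_vertices (i : 'I_m) : tgt i \in vertices.
Proof. by rewrite !inE /= codom_f orbT. Qed.

Definition srcV (i : 'I_m) : vertices := [` src_vertices i]%fset.
Definition tgtV (i : 'I_m) : vertices := [` tgt_vertices i]%fset.

Definition adj (u v : vertices) : bool :=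
  (u != v) && [exists j : 'I_m,
    [fset val u; val v]%fset == [fset src j; tgt j]%fset].

Definition is_path (x y : vertices) (S : set point) : Prop :=
  exists p : seq vertices,
    [/\ (0 < size p)%N, uniq (x :: p), path adj x p, last x p = y &
        S = \bigcup_(r in `I_(size p))
              segment (val (nth x (x :: p) r)) (val (nth x (x :: p) r.+1))]
    /\ S `<=` network.

Definition con (u v : vertices) : R :=
  if adj u v then (enorm (val u - val v))^-1 else 0.

Definition ctot (u : vertices) : R := \sum_(w | adj w u) con u w.

Definition Delta (u0 u v : vertices) : R :=
  if u == v then (u == u0)%:R + ctot u else - con u v.

Definition Delta_mx (u0 : vertices) : 'M[R]_#|{: vertices}| :=
  \matrix_(p, q) Delta u0 (enum_val p) (enum_val q).

Definition Sigma (u0 u v : vertices) : R :=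
  invmx (Delta_mx u0) (enum_rank u) (enum_rank v).

Definition bridge_cov (i : 'I_m) (u v : point) : R :=
  Num.min (enorm (u - src i) * enorm (v - tgt i))
          (enorm (v - src i) * enorm (u - tgt i)) / len i.

End Network.

Section Gaussian.
Context d (T : measurableType d) (R : realType) (P : probability T R).

(* A degenerate Gaussian law is a Dirac mass; the library's normal_prob with
   zero deviation is a different measure, hence the case distinction. *)
Definition gaussian_law (X : T -> R) : Prop :=
  exists mu sigma : R, forall A : set R, measurable A ->
    P (X @^-1` A) = if sigma == 0 then \d_mu A else normal_prob mu sigma A.

Definition centered_gaussian (I : Type) (D : set I) (X : I -> {RV P >-> R})
    (K : I -> I -> R) : Prop :=
  [/\ forall (n : nat) (x : 'I_n -> I) (c : 'I_n -> R), (forall r, D (x r)) ->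
        gaussian_law (fun w => \sum_(r < n) c r * X (x r) w),
      forall x, D x -> ('E_P[X x] = 0)%E &
      forall x y, D x -> D y -> (covariance P (X x) (X y) = (K x y)%:E)%E].

End Gaussian.

Section Resistance.
Context d (T : measurableType d) (R : realType) (P : probability T R).
Context (k : nat) (N : linear_network R k).
Variables (B0 : vertices N -> {RV P >-> R}).
Variables (B : 'I_(nseg N) -> 'rV[R]_k -> {RV P >-> R}).

Definition dV (u v : vertices N) : R := fine 'V_P[B0 u \- B0 v].

(* If u lies on several segments it is a common endpoint of all of them, and
   each of them gives the value of B0 at u. *)
Definition Z0 (u : 'rV[R]_k) : T -> R :=
  if [pick i : 'I_(nseg N) | u \in seg i] is Some i then
    fun w => enorm (u - tgt i) / len i * B0 (srcV i) w
           + enorm (u - src i) / len i * B0 (tgtV i) w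
  else cst 0.

Definition Zbridge (i : 'I_(nseg N)) (u : 'rV[R]_k) : T -> R :=
  if u \in seg i then B i u else cst 0.

Definition dR (u v : 'rV[R]_k) : R :=
  fine 'V_P[Z0 u \- Z0 v]
  + \sum_(i < nseg N) fine 'V_P[Zbridge i u \- Zbridge i v].

End Resistance.

Section RealFunctions.
Context {R : realType}.
Implicit Types (D : set R) (f : R -> R).

Definition linear_on D f : Prop :=
  exists p q : R, forall x, D x -> f x = p * x + q.

Definition quadratic_on D f : Prop :=
  exists p q r : R, p != 0 /\ forall x, D x -> f x = p * x ^+ 2 + q * x + r.

(* Differentiability at t of the restriction of f to D, which is one-sided
   when t is an end point of the interval D. *)
Definition differentiable_within D f (t : R) : Prop :=
  cvg ((fun x => (f x - f t) / (x - t)) @ within D t^').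

Definition concave_on D f : Prop := @convex_function R R^o D (\- f).

End RealFunctions.

(* Main.v *)
Require Import Defs.
From HB Require Import structures.
From mathcomp Require Import all_boot all_order all_algebra finmap.
From mathcomp Require Import all_classical all_reals all_analysis.
From mathcomp Require Import ring lra.

Set Implicit Arguments.
Unset Strict Implicit.
Unset Printing Implicit Defensive.

Import Order.TTheory GRing.Theory Num.Theory.
Import numFieldNormedType.Exports.

Local Open Scope classical_set_scope.
Local Open Scope ring_scope.

(* Let x = Sigma (e_a - e_b) be the potential of a unit current entering at
   a = a_i and leaving at b = b_i. Then d_V(a, b) = x_a - x_b is the energy
   <x, Delta x> = x(u0)^2 + sum over the edges uv of con(u, v) (x_u - x_v)^2, and
   the edge ab alone contributes d_V(a, b)^2 / l_i, whence d_V(a, b) <= l_i.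
   Equality forces x to be constant along all other edges, which is impossible
   if another path joins a to b; conversely, if the edge ab is a bridge of the
   graph, the potential is l_i on one side of it and 0 on the other, up to a
   constant. The formulas for d_R are a computation with covariances: on L_j
   only the j-th bridge contributes, the others vanishing at the endpoints of
   their segments. *)

(** * Euclidean norm and closed segments *)

Section Segments.
Context {R : realType} {k : nat}.
Implicit Types x y : 'rV[R]_k.

Lemma enorm0 : enorm (0 : 'rV[R]_k) = 0.
Proof.
by rewrite /enorm big1 ?sqrtr0// => r _; rewrite mxE expr0n.
Qed.

Lemma enormZ (a : R) x : enorm (a *: x) = `|a| * enorm x.
Proof.
rewrite /enorm -sqrtr_sqr -sqrtrM ?sqr_ge0// mulr_sumr.
by congr Num.sqrt; apply: eq_bigr => r _; rewrite mxE exprMn.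
Qed.

Lemma enormBC x y : enorm (x - y) = enorm (y - x).
Proof. by rewrite -opprB -scaleN1r enormZ normrN1 mul1r. Qed.

Lemma enorm_gt0 x : x != 0 -> 0 < enorm x.
Proof.
move=> x0; rewrite /enorm sqrtr_gt0 lt0r sumr_ge0 ?andbT => [|r _]; last first.
  exact: sqr_ge0.
apply: contraNN x0 => /eqP s0; apply/eqP/rowP => r; rewrite mxE.
have /(_ r isT) := psumr_eq0P (fun r _ => sqr_ge0 (x 0 r)) s0.
by move/eqP; rewrite sqrf_eq0 => /eqP.
Qed.

Lemma segmentC x y : segment x y = segment y x.
Proof.
by apply/seteqP; split=> z [t t01 ->]; exists (1 - t); rewrite ?subKr;
  [lra|exact: addrC|lra|exact: addrC].
Qed.

Lemma segment_closed x y : closed (segment x y).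
Proof.
apply: compact_closed; first exact: norm_hausdorff.
have -> : segment x y = (fun t : R => (1 - t) *: x + t *: y) @` `[0, 1].
  apply/seteqP; split=> z.
    by case=> t t01 ->; exists t; rewrite //= in_itv.
  by case=> t /=; rewrite in_itv/= => t01 <-; exists t.
apply: continuous_compact; last exact: segment_compact.
apply: continuous_subspaceT => t.
by apply: cvgD; apply: cvgZr_tmp; [apply: cvgB; [exact: cvg_cst|]|]; exact: cvg_id.
Qed.

End Segments.

(** * Segments, vertices and adjacency of the network *)

Section NetworkGeometry.
Context {R : realType} {k : nat} (N : linear_network R k).
Implicit Types (i j : 'I_(nseg N)) (u v w : vertices N).

Lemma len_gt0 i : 0 < len i.
Proof. by rewrite enorm_gt0// subr_eq0 src_neq_tgt. Qed.

Lemma seg_pointE i (t : R) :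
  seg_point i t = (1 - t / len i) *: src i + (t / len i) *: tgt i.
Proof. by rewrite /seg_point scalerBr scalerBl scale1r addrCA -addrA addrC -addrA. Qed.

Lemma seg_point_src i (t : R) : 0 <= t -> enorm (seg_point i t - src i) = t.
Proof.
move=> t0; rewrite /seg_point addrC addKr enormZ enormBC -/(len i).
have l0 := len_gt0 i.
by rewrite ger0_norm ?divr_ge0 ?(ltW l0)// divfK// gt_eqF.
Qed.

Lemma seg_point_tgt i (t : R) :
  t <= len i -> enorm (seg_point i t - tgt i) = len i - t.
Proof.
move=> tl; have l0 := len_gt0 i.
have -> : seg_point i t - tgt i = (1 - t / len i) *: (src i - tgt i).
  rewrite seg_pointE scalerBr -addrA; congr (_ + _).
  by rewrite [in RHS]scalerBl scale1r opprB.
rewrite enormZ -/(len i) ger0_norm ?subr_ge0 ?ler_pdivrMr ?mul1r//.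
by rewrite mulrBl mul1r divfK// gt_eqF.
Qed.

Lemma seg_point_seg i (t : R) : 0 <= t <= len i -> seg i (seg_point i t).
Proof.
move=> /andP[t0 tl]; have l0 := len_gt0 i.
exists (t / len i); last exact: seg_pointE.
by rewrite divr_ge0 ?(ltW l0)//= ler_pdivrMr ?mul1r.
Qed.

Lemma segP i x : seg i x -> exists2 t, 0 <= t <= len i & x = seg_point i t.
Proof.
have l0 := len_gt0 i; case=> t /andP[t0 t1] ->; exists (t * len i).
  by rewrite mulr_ge0 ?(ltW l0)//= ler_piMl ?(ltW l0).
by rewrite seg_pointE mulfK// gt_eqF.
Qed.

Lemma seg_point0 i : seg_point i 0 = src i.
Proof. by rewrite /seg_point mul0r scale0r addr0. Qed.

Lemma seg_point_len i : seg_point i (len i) = tgt i.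
Proof.
by rewrite /seg_point divff ?gt_eqF ?len_gt0// scale1r addrC subrK.
Qed.

Lemma src_seg i : seg i (src i).
Proof. by rewrite -seg_point0; apply: seg_point_seg; rewrite lexx ltW ?len_gt0. Qed.

Lemma tgt_seg i : seg i (tgt i).
Proof. by rewrite -seg_point_len; apply: seg_point_seg; rewrite lexx ltW ?len_gt0. Qed.

Lemma seg_dist i x : seg i x ->
  0 <= enorm (x - src i) <= len i /\
  enorm (x - tgt i) = len i - enorm (x - src i).
Proof.
by case/segP => t /andP[t0 tl] ->; rewrite seg_point_src// seg_point_tgt// t0.
Qed.

Lemma seg_meet i j x : i != j -> seg i x -> seg j x ->
  (x = src i \/ x = tgt i) /\ (x = src j \/ x = tgt j).
Proof.
move=> ij xi xj; have [e|[p [e pi pj]]] := segments_meet ij.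
  by have : (segment (src i) (tgt i) `&` segment (src j) (tgt j)) x by []; rewrite e.
by have : (segment (src i) (tgt i) `&` segment (src j) (tgt j)) x by [];
  rewrite e => /= ->.
Qed.

Lemma vertexP u : exists j, u = srcV j \/ u = tgtV j.
Proof.
have := valP u; rewrite !inE /= => /orP[] /codomP[j e]; exists j;
  by [left; exact: val_inj|right; exact: val_inj].
Qed.

(** Every vertex is an endpoint of some segment j; if j differs from i, the vertex lies in the
    intersection of the two segments, which contains only common endpoints. *)
Lemma vertex_seg i u : seg i (val u) -> u = srcV i \/ u = tgtV i.
Proof.
move=> iu; have [j uj] := vertexP u; have [ij|ij] := eqVneq i j.
  by rewrite ij.
have ju : seg j (val u).
  by case: uj => ->; [exact: src_seg|exact: tgt_seg].
by have [[e|e] _] := seg_meet ij iu ju; [left|right]; exact: val_inj.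
Qed.

Lemma srcV_neq_tgtV i : srcV i != tgtV i.
Proof. by rewrite -val_eqE/= src_neq_tgt. Qed.

Lemma adjP u v : reflect
  (exists j, (u = srcV j /\ v = tgtV j) \/ (u = tgtV j /\ v = srcV j)) (adj u v).
Proof.
apply: (iffP idP) => [/andP[uv /existsP[j /eqP e]]|[j uv]]; last first.
  rewrite /adj; case: uv => -[-> ->]; [|rewrite eq_sym]; rewrite srcV_neq_tgtV/=;
  by apply/existsP; exists j; rewrite // fsetUC.
exists j; have := fset21 (val u) (val v); have := fset22 (val u) (val v).
rewrite e !in_fset2 => /orP[] /eqP ev /orP[] /eqP eu;
  (* Of the four cases, the two that send u and v to the same endpoint contradict [u != v]. *)
  rewrite -val_eqE ?ev ?eu ?eqxx//= in uv; [right|left];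
  by split; apply: val_inj.
Qed.

Lemma adj_sym u v : adj u v = adj v u.
Proof. by apply/adjP/adjP => -[j [[-> ->]|[-> ->]]]; exists j; [right|left|right|left]. Qed.

Lemma adj_irrefl u : adj u u = false.
Proof. by rewrite /adj eqxx. Qed.

Lemma con_sym u v : con u v = con v u.
Proof. by rewrite /con adj_sym enormBC. Qed.

Lemma con_ge0 u v : 0 <= con u v.
Proof. by rewrite /con; case: ifP => // _; rewrite invr_ge0 sqrtr_ge0. Qed.

Lemma con_gt0 u v : adj u v -> 0 < con u v.
Proof.
move=> uv; rewrite /con uv invr_gt0 enorm_gt0// subr_eq0 val_eqE.
by case/andP: uv.
Qed.

Lemma adj_endpoints i : adj (srcV i) (tgtV i).
Proof. by apply/adjP; exists i; left. Qed.

Lemma con_endpoints i : con (srcV i) (tgtV i) = (len i)^-1.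
Proof. by rewrite /con adj_endpoints. Qed.

End NetworkGeometry.

(** * Connectedness of the graph *)

Section Connectivity.
Context {R : realType} {k : nat} (N : linear_network R k).
Implicit Types (i j : 'I_(nseg N)) (u v w : vertices N).

Lemma connect_adj_sym : connect_sym (@adj R k N).
Proof. by apply: sym_connect_sym => u v; exact: adj_sym. Qed.

(* If the graph were disconnected, the segments of the component of u and the
   remaining ones would separate the network into two disjoint closed sets. *)
Lemma network_graph_connected u v : connect (@adj R k N) u v.
Proof.
pose F (b : bool) : set 'rV[R]_k :=
  \bigcup_(i in [set i | connect (@adj R k N) u (srcV i) = b]) seg i.
have F_closed b : closed (F b).
  apply: closed_bigcup => [|i _]; first exact: finite_finset.
  exact: segment_closed.
have side i w : seg i (val w) ->
    connect (@adj R k N) u (srcV i) = connect (@adj R k N) u w.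
  have st : connect (@adj R k N) u (srcV i) = connect (@adj R k N) u (tgtV i).
    by apply: (same_connect_r connect_adj_sym); apply/connect1/adj_endpoints.
  by case/vertex_seg => ->.
(* A point of both sets lies on two distinct segments, so it is a vertex, and [side] would make it
   both reachable and unreachable from u. *)
have F_disjoint : F true `&` F false = set0.
  apply/seteqP; split=> // x [[i /= iu ix] [j /= ju jx]].
  have ij : i != j by apply/eqP => e; rewrite e ju in iu.
  have [[e|e] _] := seg_meet ij ix jx; rewrite e in jx.
    by have := side j (srcV i) jx; rewrite ju iu.
  have := side j (tgtV i) jx; rewrite ju -(side i (tgtV i)) ?iu//.
  exact: tgt_seg.
have vertex_network w : network N (val w).
  by have [j [->|->]] := vertexP w; exists j => //; [exact: src_seg|exact: tgt_seg].
have [g [g_cont g0 g1 gN]] := network_connected (vertex_network u) (vertex_network v).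
have sep : separated (F true) (F false).
  by split; rewrite -(closure_id _).1.
have cg : connected (g @` `[0, 1]).
  by apply: connected_continuous_connected => //; exact: segment_connected.
have mem01 (t : R) : 0 <= t <= 1 -> (g @` `[0, 1]) (g t).
  by move=> t01; exists t; rewrite //= in_itv.
have cover : g @` `[0, 1] `<=` F true `|` F false.
  by move=> x /gN [i _ ix]; case E : (connect (@adj R k N) u (srcV i));
    [left|right]; exists i.
(* The connected image of [g] lies on one side. In [F true], its end v is reachable; in [F false],
   its start u would be unreachable from itself. *)
have [sub|sub] := connected_subset sep cover cg.
  have /mem01/sub : 0 <= (1 : R) <= 1 by rewrite ler01 lexx.
  by rewrite g1 => -[i /= iu /side <-]; rewrite iu.
have /mem01/sub : 0 <= (0 : R) <= 1 by rewrite lexx ler01.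
rewrite g0 => -[i /= iu /side].
by rewrite iu connect0.
Qed.

End Connectivity.

(** * The weighted Laplacian, its energy and the effective resistance *)

Section Laplacian.
Context {R : realType} {k : nat} (N : linear_network R k) (u0 : vertices N).
Implicit Types (i : 'I_(nseg N)) (u v w : vertices N) (x y : vertices N -> R).

Definition laplacian x u : R := \sum_v Delta u0 u v * x v.

Definition energy x : R := \sum_u x u * laplacian x u.

(** The diagonal term [ctot u] sums the conductances at u, so it combines with the off-diagonal
    entries into differences; only the origin keeps an extra term. *)
Lemma laplacianE x u :
  laplacian x u = (u == u0)%:R * x u + \sum_w con u w * (x u - x w).
Proof.
have ctotE : ctot u = \sum_w con u w.
  rewrite /ctot big_mkcond/=; apply: eq_bigr => w _.
  by rewrite /con adj_sym; case: adj.
have con0 : con u u = 0 by rewrite /con adj_irrefl.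
rewrite /laplacian (bigD1 u)//= {1}/Delta eqxx mulrDl -addrA; congr (_ + _).
rewrite ctotE mulr_suml.
have -> : \sum_(v | v != u) Delta u0 u v * x v = - \sum_v con u v * x v.
  rewrite [in RHS](bigD1 u)//= con0 mul0r add0r -sumrN.
  by apply: eq_bigr => v vu; rewrite /Delta eq_sym (negbTE vu) mulNr.
by rewrite -sumrB; apply: eq_bigr => w _; rewrite mulrBr.
Qed.

(** Exchanging the two summation variables and averaging turns x u (x u - x w) into a square. The
    factor 1/2 appears because the double sum counts each edge in both directions. *)
Lemma energyE x :
  energy x = x u0 ^+ 2 + 2^-1 * \sum_u \sum_w con u w * (x u - x w) ^+ 2.
Proof.
have -> : energy x = x u0 ^+ 2 + \sum_u \sum_w con u w * (x u * (x u - x w)).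
  rewrite /energy (eq_bigr (fun u => (u == u0)%:R * x u ^+ 2 +
      \sum_w con u w * (x u * (x u - x w)))) => [|u _]; last first.
    rewrite laplacianE mulrDr mulr_sumr mulrCA -expr2; congr (_ + _).
    by apply: eq_bigr => w _; rewrite mulrCA.
  rewrite big_split/= (bigD1 u0)//= eqxx mul1r big1 ?addr0// => u /negbTE ->.
  by rewrite mul0r.
set S := \sum_u _; congr (_ + _).
have SE : S = \sum_u \sum_w con u w * (x w * (x w - x u)).
  rewrite /S exchange_big/=; apply: eq_bigr => u _; apply: eq_bigr => w _.
  by rewrite con_sym.
have -> : \sum_u \sum_w con u w * (x u - x w) ^+ 2 = S + S.
  rewrite {2}SE {1}/S -big_split/=.
  apply: eq_bigr => u _; rewrite -big_split/=; apply: eq_bigr => w _.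
  by ring.
by field.
Qed.

(** All terms of the energy are nonnegative, so x vanishes at the origin and is constant along
    edges; connectedness spreads the zero to every vertex. This is the positive definiteness of
    Delta. *)
Lemma energy_eq0 x : energy x = 0 -> forall u, x u = 0.
Proof.
rewrite energyE => /eqP; rewrite paddr_eq0 ?sqr_ge0//; last first.
  rewrite mulr_ge0// sumr_ge0// => u _; rewrite sumr_ge0// => w _.
  by rewrite mulr_ge0 ?con_ge0 ?sqr_ge0.
rewrite sqrf_eq0 mulf_eq0 invr_eq0 (pnatr_eq0 _ 2)/= => /andP[/eqP x0 /eqP s0] u.
have s_ge0 v : true -> 0 <= \sum_w con v w * (x v - x w) ^+ 2.
  by move=> _; rewrite sumr_ge0// => w _; rewrite mulr_ge0 ?con_ge0 ?sqr_ge0.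
have step v w : adj v w -> x v = x w.
  move=> vw; have /psumr_eq0P h := psumr_eq0P s_ge0 s0 (i := v) isT.
  have /eqP := h (fun w' _ => mulr_ge0 (con_ge0 v w') (sqr_ge0 _)) w isT.
  by rewrite mulf_eq0 gt_eqF ?con_gt0//= sqrf_eq0 subr_eq0 => /eqP.
have /connectP[p] := network_graph_connected u0 u.
rewrite -x0; elim: p u0 {x0} => [v _ -> //|w p IHp v /= /andP[vw wp] up].
by rewrite (step _ _ vw); exact: IHp.
Qed.

Lemma Delta_sym u v : Delta u0 u v = Delta u0 v u.
Proof.
rewrite /Delta eq_sym; case: eqP => [->//|_].
by rewrite con_sym.
Qed.

Lemma Delta_mx_tr : (Delta_mx u0)^T = Delta_mx u0.
Proof. by apply/matrixP => p q; rewrite !mxE Delta_sym. Qed.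

(** A vector in the kernel has zero Laplacian, hence zero energy. *)
Lemma Delta_mx_unit : Delta_mx u0 \in unitmx.
Proof.
rewrite -row_free_unit; apply: inj_row_free => v v0.
pose x u := v 0 (enum_rank u).
have lap0 u : laplacian x u = 0.
  have /rowP/(_ (enum_rank u)) := v0; rewrite !mxE => <-.
  rewrite /laplacian (reindex _ (onW_bij _ (@enum_rank_bij (vertices N))))/=.
  by apply: eq_bigr => w _; rewrite mxE !enum_rankK mulrC Delta_sym.
have x0 : energy x = 0 by rewrite /energy big1// => u _; rewrite lap0 mulr0.
apply/rowP => p; rewrite mxE -(energy_eq0 x0 (enum_val p)).
by rewrite /x enum_valK.
Qed.

Lemma Sigma_sym u v : Sigma u0 u v = Sigma u0 v u.
Proof. by rewrite /Sigma -[in LHS]Delta_mx_tr -trmx_inv mxE. Qed.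

Lemma laplacian_Sigma u v : laplacian (fun w => Sigma u0 w v) u = (u == v)%:R.
Proof.
have /matrixP/(_ (enum_rank u) (enum_rank v)) := mulmxV Delta_mx_unit.
rewrite !mxE (inj_eq enum_rank_inj) => <-.
rewrite /laplacian (reindex _ (onW_bij _ (@enum_rank_bij (vertices N))))/=.
by apply: eq_bigr => w _; rewrite mxE !enum_rankK.
Qed.

Lemma Sigma_laplacian x u : \sum_v Sigma u0 u v * laplacian x v = x u.
Proof.
rewrite /laplacian; under eq_bigr do rewrite mulr_sumr.
rewrite exchange_big/= (eq_bigr (fun w => (w == u)%:R * x w)) => [|w _]; last first.
  under eq_bigr do rewrite mulrA.
  rewrite -mulr_suml; congr (_ * _); rewrite -laplacian_Sigma /laplacian.
  by apply: eq_bigr => v _; rewrite mulrC Delta_sym Sigma_sym.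
by rewrite (bigD1 u)//= eqxx mul1r big1 ?addr0// => w /negbTE ->; rewrite mul0r.
Qed.

(** The metric d_V in terms of Sigma alone, so that the network argument is free of probability;
    [dV_resistance] makes the link. *)
Definition resistance u v : R :=
  Sigma u0 u u + Sigma u0 v v - 2 * Sigma u0 u v.

Definition potential a b w : R := Sigma u0 w a - Sigma u0 w b.

Lemma laplacian_potential a b u :
  laplacian (potential a b) u = (u == a)%:R - (u == b)%:R.
Proof.
rewrite -!laplacian_Sigma /laplacian -sumrB.
by apply: eq_bigr => v _; rewrite mulrBr.
Qed.

Lemma resistance_potential a b :
  resistance a b = potential a b a - potential a b b.
Proof. by rewrite /resistance /potential (Sigma_sym b a); ring. Qed.

Lemma sum_delta (a : vertices N) (F : vertices N -> R) :
  \sum_u F u * (u == a)%:R = F a.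
Proof.
by rewrite (bigD1 a)//= eqxx mulr1 big1 ?addr0// => w /negbTE ->; rewrite mulr0.
Qed.

Lemma energy_potential a b : energy (potential a b) = resistance a b.
Proof.
rewrite resistance_potential /energy.
under eq_bigr do rewrite laplacian_potential mulrBr.
by rewrite sumrB !sum_delta.
Qed.

(** Since Delta is invertible, the Laplacian determines the function. This allows the resistance to
    be read off from an explicit guess for the potential. *)
Lemma potential_unique a b y :
  (forall u, laplacian y u = (u == a)%:R - (u == b)%:R) ->
  resistance a b = y a - y b.
Proof.
move=> yE; rewrite resistance_potential.
suff yP w : y w = potential a b w by rewrite !yP.
rewrite -(Sigma_laplacian y); under eq_bigr do rewrite yE mulrBr.
by rewrite sumrB !sum_delta.
Qed.

Variable i : 'I_(nseg N).
Local Notation a := (srcV i).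
Local Notation b := (tgtV i).

(** The graph without the edge ab. That edge is a bridge of the graph exactly when this relation
    does not connect a to b. *)
Definition adj_off u v : bool :=
  adj u v && ~~ (((u == a) && (v == b)) || ((u == b) && (v == a))).

Definition con_off u v : R := if adj_off u v then con u v else 0.

Lemma adj_off_sym u v : adj_off u v = adj_off v u.
Proof. by rewrite /adj_off adj_sym orbC (andbC (v == b)) (andbC (v == a)). Qed.

Lemma con_off_ge0 u v : 0 <= con_off u v.
Proof. by rewrite /con_off; case: ifP; rewrite ?con_ge0. Qed.

(** Isolates the conductance of the edge ab; its two summands are the two orientations of that edge,
    which exclude each other because a and b are distinct. *)
Lemma con_split u v : con u v = con_off u v +
  (len i)^-1 * ((u == a)%:R * (v == b)%:R + (u == b)%:R * (v == a)%:R).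
Proof.
have ab := srcV_neq_tgtV i; have ba : b != a by rewrite eq_sym.
rewrite /con_off /adj_off; have [->|ua] := eqVneq u a.
  rewrite (negbTE ab) !(mul0r, addr0, mul1r, orbF) /=.
  have [->|vb] /= := eqVneq v b; first by rewrite andbF con_endpoints mulr1 add0r.
  by rewrite mulr0 addr0 andbT /con; case: ifP.
have [->|ub] /= := eqVneq u b.
  rewrite mul0r add0r mul1r; have [->|va] /= := eqVneq v a.
    by rewrite andbF con_sym con_endpoints mulr1 add0r.
  by rewrite mulr0 addr0 andbT /con; case: ifP.
by rewrite !mul0r addr0 mulr0 addr0 andbT /con; case: ifP.
Qed.

Lemma laplacian_split x u : laplacian x u =
  (u == u0)%:R * x u + (len i)^-1 * (x a - x b) * ((u == a)%:R - (u == b)%:R)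
  + \sum_w con_off u w * (x u - x w).
Proof.
rewrite laplacianE -addrA; congr (_ + _); rewrite addrC.
under eq_bigr do rewrite con_split mulrDl.
rewrite big_split/=; congr (_ + _).
rewrite (eq_bigr (fun w => ((len i)^-1 * (u == a)%:R * (x u - x w)) * (w == b)%:R
  + ((len i)^-1 * (u == b)%:R * (x u - x w)) * (w == a)%:R))
  => [|w _]; last by ring.
rewrite big_split/= !sum_delta.
have [->|ua] := eqVneq u a; first by rewrite (negbTE (srcV_neq_tgtV i)) /=; ring.
by have [->|ub] := eqVneq u b => /=; ring.
Qed.

(** The double sum meets the edge ab in both directions, which cancels the factor 1/2 for this
    edge. *)
Lemma energy_split x : energy x = x u0 ^+ 2 + (len i)^-1 * (x a - x b) ^+ 2
  + 2^-1 * \sum_u \sum_w con_off u w * (x u - x w) ^+ 2.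
Proof.
rewrite energyE -addrA; congr (_ + _).
rewrite (eq_bigr (fun u => (\sum_w con_off u w * (x u - x w) ^+ 2)
   + ((len i)^-1 * (x u - x b) ^+ 2 * (u == a)%:R
   + (len i)^-1 * (x u - x a) ^+ 2 * (u == b)%:R))) => [|u _]; last first.
  under eq_bigr do rewrite con_split mulrDl.
  rewrite big_split/=; congr (_ + _).
  rewrite (eq_bigr (fun w => ((len i)^-1 * (u == a)%:R * (x u - x w) ^+ 2)
      * (w == b)%:R + ((len i)^-1 * (u == b)%:R * (x u - x w) ^+ 2)
      * (w == a)%:R)) => [|w _]; last by ring.
  by rewrite big_split/= !sum_delta; ring.
by rewrite big_split/= big_split/= !sum_delta; field; rewrite gt_eqF ?len_gt0.
Qed.

Lemma resistance_le_len : resistance a b <= len i.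
Proof.
have l0 := len_gt0 i; set d := resistance a b.
have dE : (len i)^-1 * d ^+ 2 <= d.
  rewrite -[leRHS]energy_potential energy_split -resistance_potential -/d.
  rewrite addrAC lerDr addr_ge0 ?sqr_ge0// mulr_ge0// sumr_ge0// => u _.
  by rewrite sumr_ge0// => w _; rewrite mulr_ge0 ?con_off_ge0 ?sqr_ge0.
(* Cancelling d in d^2 <= l_i d needs d > 0; otherwise the bound is immediate. *)
have [/le_trans->//|d0] := lerP d 0; first exact: ltW.
by rewrite ler_pdivrMl// expr2 ler_pM2r in dE.
Qed.

(* On a bridge edge the potential is [len i] on the side of a and [0] on the
   side of b, up to the constant fixed by its vanishing at u0. *)
Lemma resistance_eq_len : resistance a b = len i <-> ~~ connect adj_off a b.
Proof.
have l0 := len_gt0 i; split=> [d_len|nab].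
  apply/negP => /connectP[p ap bp].
  have := energy_potential a b; rewrite energy_split -resistance_potential.
  set x := potential a b; rewrite d_len (expr2 (len i)) mulKf ?gt_eqF// => e0.
  have s_ge0 u : true -> 0 <= \sum_w con_off u w * (x u - x w) ^+ 2.
    by move=> _; rewrite sumr_ge0// => w _; rewrite mulr_ge0 ?con_off_ge0 ?sqr_ge0.
  (* When d = l_i the edge ab already carries the whole energy, so nothing is left for the other
     edges. *)
  have s0 : \sum_u \sum_w con_off u w * (x u - x w) ^+ 2 = 0.
    have := sqr_ge0 (x u0); have := sumr_ge0 (index_enum (vertices N)) s_ge0.
    by move: e0; set S := \sum_u _; lra.
  have step v w : adj_off v w -> x v = x w.
    move=> vw; have /psumr_eq0P h := psumr_eq0P s_ge0 s0 (i := v) isT.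
    have /eqP := h (fun w' _ => mulr_ge0 (con_off_ge0 v w') (sqr_ge0 _)) w isT.
    rewrite mulf_eq0 sqrf_eq0 subr_eq0 {1}/con_off vw gt_eqF ?con_gt0//= => [/eqP//|].
    by case/andP: vw.
  (* Following a path that avoids the edge ab gives zero resistance, contrary to l_i > 0. *)
  have x_ab : x a = x b.
    elim: p (a) ap bp => [v _ -> //|w p IHp v /= /andP[vw wp] bp].
      by rewrite (step _ _ vw); exact: IHp.
  by move: d_len; rewrite resistance_potential -/x x_ab subrr => l; rewrite -l ltxx in l0.
pose h u : R := len i * (connect adj_off a u)%:R.
have sym_off : connect_sym adj_off.
  by apply: sym_connect_sym => u v; exact: adj_off_sym.
(* Every edge other than ab stays within one component of the reduced graph, where [h] is
   constant. *)
have h_step u w : con_off u w * (h u - h w) = 0.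
  rewrite /con_off; case: ifP => [uw|_]; last by rewrite mul0r.
  by rewrite /h (same_connect_r sym_off (connect1 uw)) subrr mulr0.
have ha : h a = len i by rewrite /h connect0 mulr1.
have hb : h b = 0 by rewrite /h (negbTE nab) mulr0.
rewrite (@potential_unique a b (fun u => h u - h u0)) ?ha ?hb; first by ring.
move=> u; rewrite laplacian_split big1 ?addr0 => [|w _]; last first.
  by rewrite opprB addrA subrK h_step.
have -> : (u == u0)%:R * (h u - h u0) = 0.
  by have [->|_] := eqVneq u u0; rewrite ?subrr ?mulr0 ?mul0r.
by rewrite ha hb; field; rewrite gt_eqF.
Qed.

End Laplacian.

(** * Paths as point sets, and removal of an edge *)

Section Paths.
Context {R : realType} {k : nat} (N : linear_network R k) (i : 'I_(nseg N)).
Implicit Types u v w : vertices N.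
Local Notation a := (srcV i).
Local Notation b := (tgtV i).

Lemma adj_segment u v : adj u v -> segment (val u) (val v) `<=` network N.
Proof.
by move=> /adjP[j [[-> ->]|[-> ->]]] x; [|rewrite segmentC]; exists j.
Qed.

Lemma path_subset_network (x : vertices N) (p : seq (vertices N)) :
  path (@adj R k N) x p ->
  \bigcup_(r in `I_(size p))
    segment (val (nth x (x :: p) r)) (val (nth x (x :: p) r.+1)) `<=` network N.
Proof.
by move=> /(pathP x) xp; apply: bigcup_sub => r /= rp; exact/adj_segment/xp.
Qed.

Lemma adj_off_path w p :
  path (@adj R k N) w p -> a \notin w :: p -> path (adj_off i) w p.
Proof.
elim: p w => //= v p IHp w /andP[wv vp]; rewrite !inE !negb_or => /and3P[aw av ap].
rewrite IHp// ?inE ?negb_or ?av// andbT /adj_off wv /=.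
by rewrite (eq_sym w a) (negbTE aw) (eq_sym v a) (negbTE av) andbF.
Qed.

Lemma is_path_seg : is_path a b (seg i).
Proof.
exists [:: b]; split; last by move=> x ix; exists i.
split=> //=.
- by rewrite inE andbT srcV_neq_tgtV.
- by rewrite adj_endpoints.
apply/seteqP; split=> x; first by exists 0%N.
by case=> -[].
Qed.

(** A simple path from a whose first step does not go to b never uses the edge ab, since it does not
    return to a. Conversely, a walk avoiding ab shortens to a simple path; as paths are compared as
    point sets, it must be shown that this one is not [seg i]. *)
Lemma connect_off_iff_other_path :
  ~~ connect (adj_off i) a b <-> [set Q | is_path a b Q] = [set seg i].
Proof.
split=> [nab|paths_seg].
  apply/seteqP; split=> Q /=; last by move=> ->; exact: is_path_seg.
  case=> -[|w p] [[//= _ /and3P[]]]; rewrite inE negb_or => /andP[aw ap] wp up.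
  (* If the first step reaches b, distinctness of the vertices stops the path there, because b is
     also its last vertex. *)
  move=> /andP[adj_aw adj_p] pb -> _; have [wb|wb] := eqVneq w b.
    case: p {ap up adj_p} => [|v p] in wp pb *; last first.
      by move: wp; rewrite wb -pb /= mem_last.
    rewrite -[seg i]/(segment (val a) (val b)) -wb.
    by apply/seteqP; split=> x /=; [case=> -[]|exists 0%N].
  exfalso; apply/negP: nab; rewrite negbK; apply/connectP; exists (w :: p) => //=.
  rewrite adj_off_path ?inE ?negb_or ?aw// andbT /adj_off adj_aw/= eqxx (negbTE wb).
  by rewrite (negbTE (srcV_neq_tgtV i)).
apply/negP => /connectP[q aq qb]; case/shortenP: aq qb => p ap up _ pb.
have adj_p : path (@adj R k N) a p by apply: sub_path ap => u v /andP[].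
case: p => [|w p] in ap up pb adj_p *.
  by have := srcV_neq_tgtV i; rewrite pb eqxx.
pose Q := \bigcup_(r in `I_(size (w :: p)))
  segment (val (nth a (a :: w :: p) r)) (val (nth a (a :: w :: p) r.+1)).
have : [set Q | is_path a b Q] Q.
  exists (w :: p); split; last exact: path_subset_network.
  by split.
rewrite paths_seg /= => QE.
(* The second vertex w would lie on [seg i], so it is a or b. The first repeats a; the second either
   uses the deleted edge or repeats b at the end. *)
have : seg i (val w).
  rewrite -QE; exists 0%N => //=; exists 1; first by rewrite lexx ler01.
  by rewrite subrr scale0r scale1r add0r.
case/vertex_seg => wE; first by rewrite wE /= inE eqxx in up.
case: p => [|v p] in ap up pb adj_p Q QE *.
  by move: ap; rewrite /= wE /adj_off !eqxx andbF.
by move: up; rewrite /= wE pb /= mem_last andbF.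
Qed.

End Paths.

(** * Square integrability and bilinearity of the covariance *)

Section Covariance.
Context d (T : measurableType d) (R : realType) (P : probability T R).
Implicit Types X Y Z : T -> R.

(** For mean zero, the covariance of X with itself is the integral of X^2, and its finiteness gives
    the L^2 membership that bilinearity requires. *)
Lemma Lfun2_of_covariance (X : {RV P >-> R}) (c : R) :
  ('E_P[X] = 0)%E -> covariance P X X = c%:E -> (X : T -> R) \in Lfun P 2%:E.
Proof.
move=> EX0; rewrite unlock EX0 /= unlock => covX.
rewrite inE; apply/andP; split; rewrite inE/=; first exact: measurable_funPT.
rewrite /finite_norm unlock poweR_lty//.
rewrite (eq_integral (fun w => (((X \- cst 0) * (X \- cst 0)) w)%:E)) ?covX ?ltry//.
move=> w _; rewrite /= powR_mulrn// real_normK ?num_real//.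
by rewrite fctE/= subr0 -expr2.
Qed.

Lemma Lfun2_linear (p q : R) X Y :
  X \in Lfun P 2%:E -> Y \in Lfun P 2%:E ->
  (fun w => p * X w + q * Y w) \in Lfun P 2%:E.
Proof.
move=> X2 Y2; have -> : (fun w => p * X w + q * Y w) = (p \o* X) \+ (q \o* Y).
  by apply/funext => w /=; rewrite mulrC (mulrC q).
have Z2 (c : R) Z : Z \in Lfun P 2%:E -> c \o* Z \in Lfun P 2%:E.
  by apply: Lfun_scale; rewrite ler1n.
by apply: (rpredD (Z2 p _ X2) (Z2 q _ Y2)); rewrite lee_fin ler1n.
Qed.

Lemma covariance_linear_l (p q : R) X Y Z :
  X \in Lfun P 2%:E -> Y \in Lfun P 2%:E -> Z \in Lfun P 2%:E ->
  covariance P (fun w => p * X w + q * Y w) Z =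
  (p%:E * covariance P X Z + q%:E * covariance P Y Z)%E.
Proof.
move=> X2 Y2 Z2; have -> : (fun w => p * X w + q * Y w) = (p \o* X) \+ (q \o* Y).
  by apply/funext => w /=; rewrite mulrC (mulrC q).
have Pfin : P setT \is a fin_num := fin_num_measure P _ measurableT.
rewrite covarianceDl ?Lfun_scale ?ler1n//.
by rewrite !covarianceZl ?Lfun2_mul_Lfun1 ?(Lfun_subset12 Pfin).
Qed.

Lemma covariance_linear_r (p q : R) X Y Z :
  X \in Lfun P 2%:E -> Y \in Lfun P 2%:E -> Z \in Lfun P 2%:E ->
  covariance P Z (fun w => p * X w + q * Y w) =
  (p%:E * covariance P Z X + q%:E * covariance P Z Y)%E.
Proof.
by move=> X2 Y2 Z2; rewrite !(covarianceC _ Z) covariance_linear_l.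
Qed.

Lemma fine_varianceB X Y (a b c : R) :
  X \in Lfun P 2%:E -> Y \in Lfun P 2%:E ->
  covariance P X X = a%:E -> covariance P Y Y = b%:E ->
  covariance P X Y = c%:E ->
  fine 'V_P[X \- Y] = a + b - 2 * c.
Proof. by move=> X2 Y2 aE bE cE; rewrite varianceB// /variance aE bE cE. Qed.

End Covariance.

(** * The metric on the network computed from covariances *)

Section ResistanceMetric.
Context {R : realType} {k : nat} (N : linear_network R k) (u0 : vertices N).
Context d (T : measurableType d) (P : probability T R).
Context (B0 : vertices N -> {RV P >-> R}).
Context (B : 'I_(nseg N) -> 'rV[R]_k -> {RV P >-> R}).
Hypothesis hB0 : centered_gaussian [set: vertices N] B0 (Sigma u0).
Hypothesis hB : forall i, centered_gaussian (seg i) (B i) (bridge_cov i).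
Implicit Types (i j r : 'I_(nseg N)) (x y : 'rV[R]_k).
Local Notation S := (Sigma u0).

Lemma cov_B0 v w : covariance P (B0 v) (B0 w) = (S v w)%:E.
Proof. by have [_ _] := hB0; exact. Qed.

Lemma B0_L2 v : (B0 v : T -> R) \in Lfun P 2%:E.
Proof. by have [_ E0 _] := hB0; apply: Lfun2_of_covariance (cov_B0 v v); exact: E0. Qed.

#[local] Hint Resolve B0_L2 : core.

Lemma dV_resistance v w : dV B0 v w = resistance u0 v w.
Proof. by rewrite /dV (fine_varianceB _ _ (cov_B0 v v) (cov_B0 w w) (cov_B0 v w)). Qed.

(** The value of [Z0] on segment i, with the distance to [tgt i] replaced so that only the distance
    to [src i] occurs. *)
Definition interp i x : T -> R := fun w =>
  (len i - enorm (x - src i)) / len i * B0 (srcV i) w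
  + enorm (x - src i) / len i * B0 (tgtV i) w.

Lemma interp_vertex i v : v = srcV i \/ v = tgtV i -> interp i (val v) = B0 v.
Proof.
have l0 : len i != 0 by rewrite gt_eqF ?len_gt0.
case=> ->; apply/funext => w; rewrite /interp/=.
  by rewrite subrr enorm0 subr0 divff// !mul0r mul1r addr0.
by rewrite enormBC -/(len i) subrr divff// !mul0r mul1r add0r.
Qed.

(** The segment picked by [Z0] may differ from i, but then x is a common endpoint and both
    interpolations equal [B0] there. *)
Lemma Z0_interp i x : seg i x -> Z0 B0 x = interp i x.
Proof.
move=> ix; rewrite /Z0; case: pickP => [j|/(_ i)]; last by rewrite mem_set.
move/set_mem => jx; have [_ tgtE] := seg_dist jx.
have -> : (fun w => enorm (x - tgt j) / len j * B0 (srcV j) w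
   + enorm (x - src j) / len j * B0 (tgtV j) w) = interp j x by rewrite tgtE.
have [->//|ij] := eqVneq j i.
have [xj xi] := seg_meet ij jx ix.
have [v xv vj] : exists2 v, x = val v & v = srcV j \/ v = tgtV j.
  by case: xj => xE; [exists (srcV j)|exists (tgtV j)] => //; [left|right].
rewrite xv !interp_vertex//.
by case: xi => xE; [left|right]; apply: val_inj; rewrite -xv.
Qed.

Lemma interp_L2 i x : interp i x \in Lfun P 2%:E.
Proof. by apply: Lfun2_linear. Qed.

Lemma cov_interp i j x y :
  let s := enorm (x - src j) / len j in let t := enorm (y - src i) / len i in
  covariance P (interp j x) (interp i y) =
  ((1 - s) * (1 - t) * S (srcV j) (srcV i) + (1 - s) * t * S (srcV j) (tgtV i)
   + s * (1 - t) * S (tgtV j) (srcV i) + s * t * S (tgtV j) (tgtV i))%:E.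
Proof.
move=> s t; rewrite covariance_linear_l ?interp_L2//.
rewrite !covariance_linear_r// !cov_B0.
have l0 r : len r != 0 by rewrite gt_eqF ?len_gt0.
rewrite -!EFinM -!EFinD /s /t; congr (_%:E).
by field; rewrite !l0.
Qed.

(** Here s and t are fractions of the lengths. The case i = j is included, so the formula serves
    both (A) and (B). *)
Lemma variance_Z0 i j x y : seg j x -> seg i y ->
  let s := enorm (x - src j) / len j in let t := enorm (y - src i) / len i in
  fine 'V_P[Z0 B0 x \- Z0 B0 y] =
    (1 - s) ^+ 2 * S (srcV j) (srcV j) + s ^+ 2 * S (tgtV j) (tgtV j)
    + 2 * (s * (1 - s)) * S (srcV j) (tgtV j)
    + (1 - t) ^+ 2 * S (srcV i) (srcV i) + t ^+ 2 * S (tgtV i) (tgtV i)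
    + 2 * (t * (1 - t)) * S (srcV i) (tgtV i)
    - 2 * ((1 - s) * (1 - t) * S (srcV j) (srcV i)
           + (1 - s) * t * S (srcV j) (tgtV i)
           + s * (1 - t) * S (tgtV j) (srcV i) + s * t * S (tgtV j) (tgtV i)).
Proof.
move=> jx iy s t; rewrite (Z0_interp jx) (Z0_interp iy).
rewrite (fine_varianceB (interp_L2 _ _) (interp_L2 _ _)
  (cov_interp _ _ _ _) (cov_interp _ _ _ _) (cov_interp _ _ _ _)) -/s -/t.
by rewrite (Sigma_sym u0 (tgtV j) (srcV j)) (Sigma_sym u0 (tgtV i) (srcV i)); ring.
Qed.

Lemma bridge_covE r x y : seg r x -> seg r y ->
  let s := enorm (x - src r) in let t := enorm (y - src r) in
  bridge_cov r x y = Num.min (s * (len r - t)) (t * (len r - s)) / len r.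
Proof. by move=> rx ry; rewrite /bridge_cov (seg_dist rx).2 (seg_dist ry).2. Qed.

(** With s and t the distances to [src r], both products in the minimum contain - s t, so comparing
    them amounts to comparing s with t. *)
Lemma bridge_cov_le r x y : seg r x -> seg r y ->
  enorm (x - src r) <= enorm (y - src r) ->
  bridge_cov r x y = enorm (x - src r) * (len r - enorm (y - src r)) / len r.
Proof.
move=> rx ry xy; rewrite bridge_covE//; congr (_ / _).
rewrite min_l// !mulrBr (mulrC (enorm (y - _))) (mulrC (enorm (x - _))) lerB//.
  by rewrite ler_wpM2l// ltW ?len_gt0.
by rewrite mulrC.
Qed.

Lemma bridge_covC r x y : bridge_cov r x y = bridge_cov r y x.
Proof. by rewrite /bridge_cov minC. Qed.

Lemma bridge_cov_endpoint r x y : seg r y -> x = src r \/ x = tgt r ->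
  bridge_cov r x y = 0.
Proof.
move=> ry; have [/andP[y0 yl] _] := seg_dist ry; case=> ->.
  by rewrite bridge_cov_le ?subrr ?enorm0 ?mul0r//; exact: src_seg.
have tgtE : enorm (tgt r - src r) = len r by rewrite enormBC.
rewrite bridge_covC bridge_cov_le ?tgtE//; last exact: tgt_seg.
by rewrite subrr mulr0 mul0r.
Qed.

Definition Zbridge_cov r x y : R :=
  if (x \in seg r) && (y \in seg r) then bridge_cov r x y else 0.

Lemma cov_Zbridge r x y :
  covariance P (Zbridge B r x) (Zbridge B r y) = (Zbridge_cov r x y)%:E.
Proof.
rewrite /Zbridge_cov /Zbridge; case: ifPn => xr /=; last by rewrite covariance_cst_l.
case: ifPn => yr; last by rewrite covariance_cst_r.
by have [_ _] := hB r; apply; exact: set_mem.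
Qed.

Lemma Zbridge_L2 r x : Zbridge B r x \in Lfun P 2%:E.
Proof.
have := cov_Zbridge r x x; rewrite /Zbridge; case: ifPn => [/set_mem rx|_ _].
  by have [_ E0 _] := hB r; apply: Lfun2_of_covariance; exact: E0.
exact: Lfun_cst.
Qed.

Lemma variance_Zbridge r x y : fine 'V_P[Zbridge B r x \- Zbridge B r y] =
  Zbridge_cov r x x + Zbridge_cov r y y - 2 * Zbridge_cov r x y.
Proof.
exact: (fine_varianceB (Zbridge_L2 _ _) (Zbridge_L2 _ _)
  (cov_Zbridge _ _ _) (cov_Zbridge _ _ _) (cov_Zbridge _ _ _)).
Qed.

Lemma Zbridge_covE r x y : seg r x -> seg r y ->
  Zbridge_cov r x y = bridge_cov r x y.
Proof. by move=> rx ry; rewrite /Zbridge_cov !mem_set. Qed.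

Lemma Zbridge_covC r x y : Zbridge_cov r x y = Zbridge_cov r y x.
Proof. by rewrite /Zbridge_cov andbC bridge_covC. Qed.

(** If x also lies on segment r, it is an endpoint of it, where the bridge is pinned to zero. *)
Lemma Zbridge_cov_off r j x y : r != j -> seg j x -> Zbridge_cov r x y = 0.
Proof.
move=> rj jx; rewrite /Zbridge_cov; case: ifP => // /andP[/set_mem rx /set_mem ry].
by apply: bridge_cov_endpoint => //; have [] := seg_meet rj rx jx.
Qed.

Lemma Zbridge_cov_diag r x : seg r x -> let s := enorm (x - src r) in
  Zbridge_cov r x x = s * (len r - s) / len r.
Proof. by move=> rx; rewrite Zbridge_covE// bridge_cov_le. Qed.

Definition edge_coef i : R := resistance u0 (srcV i) (tgtV i) / len i ^+ 2 - 1 / len i.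

(** The linear part [Z0] contributes d_V (t - s)^2 / l_i^2 and the i-th bridge contributes |t - s| -
    (t - s)^2 / l_i. *)
Lemma dR_same_segment i x y : seg i x -> seg i y ->
  let s := enorm (x - src i) in let t := enorm (y - src i) in
  dR B0 B x y = edge_coef i * (t - s) ^+ 2 + `|t - s|.
Proof.
move=> ix iy s t; rewrite /dR (variance_Z0 ix iy) (bigD1 i)//=.
rewrite big1 => [|r ri]; last first.
  rewrite variance_Zbridge !(Zbridge_cov_off _ ri ix).
  by rewrite !(Zbridge_cov_off _ ri iy) mulr0 subr0 addr0.
rewrite addr0 variance_Zbridge !Zbridge_cov_diag// -/s -/t Zbridge_covE//.
have l0 : len i != 0 by rewrite gt_eqF ?len_gt0.
rewrite /edge_coef /resistance (Sigma_sym u0 (tgtV i) (srcV i)).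
have [st|/ltW ts] := leP s t.
  by rewrite bridge_cov_le// -/s -/t ger0_norm ?subr_ge0//; field.
by rewrite bridge_covC bridge_cov_le// -/s -/t ler0_norm ?subr_le0//; field.
Qed.

(** The bridges contribute s (l_j - s) / l_j and t (l_i - t) / l_i. The latter supplies the leading
    1 in B_ij and the - 1 / l_i in A_i; the rest comes from [variance_Z0], ordered by powers of
    t. *)
Lemma dR_other_segment i j x y : i != j -> seg j x -> seg i y ->
  let s := enorm (x - src j) in let t := enorm (y - src i) in
  let ai := srcV i in let bi := tgtV i in
  let aj := srcV j in let bj := tgtV j in
  let li := len i in let lj := len j in
  dR B0 B x y = edge_coef i * t ^+ 2
  + (1 - 2 / li *
    (S ai ai - S ai bi
     - (lj - s) / lj * S aj ai + (lj - s) / lj * S aj bi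
     - s / lj * S bj ai + s / lj * S bj bi)) * t
  + ((lj - s) ^+ 2 / lj ^+ 2 * S aj aj + s ^+ 2 / lj ^+ 2 * S bj bj
    + 2 * (s * (lj - s) / lj ^+ 2) * S aj bj + S ai ai
    - 2 * ((lj - s) / lj) * S aj ai - 2 * (s / lj) * S bj ai
    + s * (lj - s) / lj).
Proof.
move=> ij jx iy s t ai bi aj bj li lj; have ji : j != i by rewrite eq_sym.
rewrite /dR (variance_Z0 jx iy) (bigD1 i)//= (bigD1 j)//=.
rewrite big1 => [|r /andP[ri rj]]; last first.
  rewrite variance_Zbridge !(Zbridge_cov_off _ rj jx).
  by rewrite !(Zbridge_cov_off _ ri iy) mulr0 subr0 addr0.
rewrite addr0 !variance_Zbridge !(Zbridge_cov_off _ ij jx) !(Zbridge_cov_off _ ji iy).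
rewrite (Zbridge_covC j x) !(Zbridge_cov_off _ ji iy) !Zbridge_cov_diag//.
rewrite -/s -/t -/ai -/bi -/aj -/bj -/li -/lj /edge_coef /resistance -/ai -/bi -/li.
have li0 : li != 0 by rewrite gt_eqF ?len_gt0.
have lj0 : lj != 0 by rewrite gt_eqF ?len_gt0.
by field; rewrite li0 lj0.
Qed.

End ResistanceMetric.

(** The difference quotient uses values at points of D and at t, which is why t has to belong to
    D. *)
Lemma differentiable_within_eq (R : realType) (D : set R) (f g : R -> R) (t : R) :
  {in D, f =1 g} -> t \in D ->
  differentiable_within D f t -> differentiable_within D g t.
Proof.
move=> fg tD /cvg_ex[l fl]; apply: (@cvgP _ _ l); apply: cvg_trans fl.
apply: near_eq_cvg; near=> y; have Dy : D y by near: y; exact: withinT.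
by rewrite !fg// mem_set.
Unshelve. all: by end_near.
Qed.

(** * The distance within one segment as a real function *)

Section QuadraticCusp.
Context {R : realType}.
Implicit Types A s l x : R.

(** The absolute value joins the two branches of (A), so continuity at s needs no gluing. *)
Definition cusp A s x : R := A * (x - s) ^+ 2 + `|x - s|.

Lemma cusp_continuous A s : continuous (cusp A s).
Proof.
move=> x; have c : (fun y => y - s) @ x --> x - s.
  by apply: cvgB; [exact: cvg_id|exact: cvg_cst].
apply: cvgD; last exact: cvg_norm.
by apply: cvgM; [exact: cvg_cst|rewrite expr2; exact: cvgM].
Qed.

Lemma cusp_differentiable_within A s (D : set R) x : x != s ->
  differentiable_within D (cusp A s) x.
Proof.
(* The sign [e] of y - s is constant for y near x, and [g] is the difference quotient after
   cancelling y - x. *)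
move=> xs; pose e : R := if s < x then 1 else -1.
pose g y := A * (y + x - 2 * s) + e.
apply: (@cvgP _ _ (g x)).
have same_side : \forall y \near x, `|y - s| = e * (y - s) /\ `|x - s| = e * (x - s).
  rewrite /e; have [sx|xs'] := ltP s x.
    near=> y; have sy : s < y by near: y; exact: lt_nbhsr.
    by rewrite !mul1r !gtr0_norm ?subr_gt0.
  have {}xs' : x < s by rewrite lt_neqAle xs.
  near=> y; have sy : y < s by near: y; exact: lt_nbhsl.
  by rewrite !mulN1r !ltr0_norm ?subr_lt0.
have eq_g : {near within D x^', g =1
    (fun y => (cusp A s y - cusp A s x) / (y - x))}.
  rewrite /within/= /dnbhs/within/=; apply: filterS same_side => y [ye xe] yx _.
  rewrite /cusp ye xe /g; field.
  by rewrite subr_eq0.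
apply: cvg_trans; first exact: (near_eq_cvg eq_g).
(* [g] is continuous, so it converges without restricting to D or deleting x. *)
apply: cvg_within_filter; apply: cvg_within_filter.
apply: cvgD; last exact: cvg_cst.
apply: cvgM; first exact: cvg_cst.
by apply: cvgB; [apply: cvgD; [exact: cvg_id|exact: cvg_cst]|exact: cvg_cst].
Unshelve. all: by end_near.
Qed.

Lemma cusp_pieces A s l :
  (A = 0 -> linear_on `[0, s] (cusp A s) /\ linear_on `[s, l] (cusp A s)) /\
  (A < 0 -> quadratic_on `[0, s] (cusp A s) /\ quadratic_on `[s, l] (cusp A s)).
Proof.
have left x : `[0, s]%classic x -> `|x - s| = s - x.
  by rewrite /= in_itv/= => /andP[_ xs]; rewrite ler0_norm ?subr_le0 ?opprB.
have right x : `[s, l]%classic x -> `|x - s| = x - s.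
  by rewrite /= in_itv/= => /andP[sx _]; rewrite ger0_norm ?subr_ge0.
split=> [->|/ltr0_neq0 A0]; split.
- by exists (-1), s => x /left xs; rewrite /cusp xs; ring.
- by exists 1, (- s) => x /right xs; rewrite /cusp xs; ring.
- exists A, (- (2 * A * s) - 1), (A * s ^+ 2 + s); split=> // x /left xs.
  by rewrite /cusp xs; ring.
- exists A, (- (2 * A * s) + 1), (A * s ^+ 2 - s); split=> // x /right xs.
  by rewrite /cusp xs; ring.
Qed.

End QuadraticCusp.

(** * Concave quadratic functions on an interval *)

Section ConcaveQuadratic.
Context {R : realType}.
Implicit Types (D : set R) (f : R -> R) (A B C l t : R).

Lemma quadratic_or_linear_on D f A B C :
  (forall x, D x -> f x = A * x ^+ 2 + B * x + C) ->
  linear_on D f \/ quadratic_on D f.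
Proof.
move=> fE; have [A0|A0] := eqVneq A 0; [left; exists B, C|right; exists A, B, C].
  by move=> x /fE ->; rewrite A0 mul0r add0r.
by split.
Qed.

(** The gap in the concavity inequality is - A q (1 - q) (x - y)^2, whatever B and C are. *)
Lemma concave_quadratic_on l f A B C : A <= 0 ->
  (forall x, 0 <= x <= l -> f x = A * x ^+ 2 + B * x + C) ->
  concave_on `[0, l] f.
Proof.
move=> A0 fE p x y /set_mem; rewrite /= in_itv/= => x01 /set_mem.
rewrite /= in_itv/= => y01.
have p0 : 0 <= p%:num by []. have p1 : p%:num <= 1 :> R by [].
rewrite !convRE /= /unstable.onem; set q : R := p%:num in p0 p1 *.
(* The formula for f is known only on [0, l], so the convex combination has to stay there. *)
have xy01 : 0 <= q * x + (1 - q) * y <= l.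
  move: x01 y01 => /andP[x0 xl] /andP[y0 yl]; rewrite addr_ge0 ?mulr_ge0 ?subr_ge0//=.
  rewrite [leRHS](_ : _ = q * l + (1 - q) * l); last by ring.
  by rewrite lerD ?ler_wpM2l ?subr_ge0.
rewrite (fE x)// (fE y)// fE//.
rewrite -subr_ge0.
have -> : q * - (A * x ^+ 2 + B * x + C) + (1 - q) * - (A * y ^+ 2 + B * y + C)
  - - (A * (q * x + (1 - q) * y) ^+ 2 + B * (q * x + (1 - q) * y) + C)
  = - A * (q * (1 - q) * (x - y) ^+ 2) by ring.
apply: mulr_ge0; first by rewrite oppr_ge0.
by apply: mulr_ge0; [apply: mulr_ge0; rewrite ?subr_ge0|exact: sqr_ge0].
Qed.

(** The slope of the chord from 0 to t is A t + B. If it is nonnegative, the value at t is at least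
    C; otherwise the chord from t to l has slope A (l + t) + B <= A t + B < 0, and the value at l is
    the smaller one. *)
Lemma quadratic_ge_min A B C l t : A <= 0 -> 0 < l -> 0 <= t <= l ->
  Num.min C (A * l ^+ 2 + B * l + C) <= A * t ^+ 2 + B * t + C.
Proof.
move=> A0 l0 /andP[t0 tl]; rewrite ge_min -(subr_ge0 C) -(subr_ge0 (_ + C)).
have -> : A * t ^+ 2 + B * t + C - C = t * (A * t + B) by ring.
have -> : A * t ^+ 2 + B * t + C - (A * l ^+ 2 + B * l + C)
  = (l - t) * - (A * (l + t) + B) by ring.
have [h|h] := leP 0 (A * t + B); first by rewrite mulr_ge0.
rewrite [X in _ || X]mulr_ge0 ?orbT ?subr_ge0// oppr_ge0 mulrDr.
by have : A * l <= 0; [rewrite mulr_le0_ge0// ltW|lra].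
Qed.

End ConcaveQuadratic.

(** * Sign and vanishing of A_i *)

Section EdgeCoefficient.
Context {R : realType} {k : nat} (N : linear_network R k) (u0 : vertices N).
Implicit Type i : 'I_(nseg N).

Lemma edge_coefE i :
  edge_coef u0 i = (resistance u0 (srcV i) (tgtV i) - len i) / len i ^+ 2.
Proof. by rewrite /edge_coef; field; rewrite gt_eqF ?len_gt0. Qed.

Lemma edge_coef_le0 i : edge_coef u0 i <= 0.
Proof.
rewrite edge_coefE pmulr_lle0 ?subr_le0 ?resistance_le_len//.
by rewrite invr_gt0 exprn_gt0 ?len_gt0.
Qed.

Lemma edge_coef_eq0 i : edge_coef u0 i = 0 <->
  [set Q | is_path (srcV i) (tgtV i) Q] = [set seg i].
Proof.
have l0 : (len i ^+ 2)^-1 != 0 by rewrite invr_eq0 expf_neq0 ?gt_eqF ?len_gt0.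
rewrite -connect_off_iff_other_path -(resistance_eq_len u0) edge_coefE.
split=> [/eqP|->]; last by rewrite subrr mul0r.
by rewrite mulf_eq0 (negbTE l0) orbF subr_eq0 => /eqP.
Qed.

End EdgeCoefficient.

(** * Assembly of (A), (B) and (C) *)

Theorem proposition1 (R : realType) (k : nat) (N : linear_network R k)
    (u0 : vertices N)
    (disp : measure_display) (T : measurableType disp) (P : probability T R)
    (B0 : vertices N -> {RV P >-> R})
    (B : 'I_(nseg N) -> 'rV[R]_k -> {RV P >-> R})
    (hB0 : centered_gaussian [set: vertices N] B0 (Sigma u0))
    (hB : forall i, centered_gaussian (seg i) (B i) (bridge_cov i))
    (i j : 'I_(nseg N)) (u v : 'rV[R]_k) (hu : seg j u) (hv : seg i v) :
  let dR := dR B0 B in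
  let S := Sigma u0 in
  let li := len i in
  let lj := len j in
  let ai := srcV i in
  let bi := tgtV i in
  let aj := srcV j in
  let bj := tgtV j in
  let s := enorm (u - src j) in
  let t := enorm (v - src i) in
  let Ai := dV B0 ai bi / li ^+ 2 - 1 / li in
  let Bij := 1 - 2 / li *
    (S ai ai - S ai bi
     - (lj - s) / lj * S aj ai + (lj - s) / lj * S aj bi
     - s / lj * S bj ai + s / lj * S bj bi) in
  let Cij := (lj - s) ^+ 2 / lj ^+ 2 * S aj aj + s ^+ 2 / lj ^+ 2 * S bj bj
    + 2 * (s * (lj - s) / lj ^+ 2) * S aj bj + S ai ai
    - 2 * ((lj - s) / lj) * S aj ai - 2 * (s / lj) * S bj ai
    + s * (lj - s) / lj in
  let f := fun x : R => dR u (seg_point i x) in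
  [/\ Ai <= 0,
      Ai = 0 <-> [set Q | is_path ai bi Q] = [set seg i],
      (i = j ->
        [/\ (s <= t -> dR u v = Ai * (t - s) ^+ 2 + t - s)
              /\ (t <= s -> dR u v = Ai * (s - t) ^+ 2 + s - t),
            (Ai = 0 -> linear_on `[0, s] f /\ linear_on `[s, li] f)
              /\ (Ai < 0 -> quadratic_on `[0, s] f /\ quadratic_on `[s, li] f),
            {within `[0, li], continuous f} &
            forall x, x \in `[0, li] -> x != s ->
              differentiable_within `[0, li] f x]) &
      (i != j ->
        [/\ dR u v = Ai * t ^+ 2 + Bij * t + Cij,
            linear_on `[0, li] f \/ quadratic_on `[0, li] f,
            concave_on `[0, li] f &
            Num.min (dR u (src i)) (dR u (tgt i)) <= dR u v])].
Proof.
move=> dR S li lj ai bi aj bj s t Ai Bij Cij f.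
have AiE : Ai = edge_coef u0 i by rewrite /Ai (dV_resistance hB0).
have li0 : 0 < li := len_gt0 i.
have [/andP[s0 sl] _] := seg_dist hu.
have [/andP[t0 tl] _] := seg_dist hv.
have Ai0 : Ai <= 0 by rewrite AiE edge_coef_le0.
split=> //; first by rewrite AiE edge_coef_eq0.
  move=> ij; have hui : seg i u by rewrite ij.
  have sE : enorm (u - src i) = s by rewrite ij.
  have {}sl : s <= li by rewrite /li ij.
  (* The identity is confined to [0, l_i], where [seg_point i x] lies on L_i; continuity,
     differentiability and the shape of f are then transferred from [cusp] within that interval. *)
  have fE : {in `[0, li]%classic, cusp Ai s =1 f}.
    move=> x /set_mem; rewrite /= in_itv/= => x0l; have /andP[x0 _] := x0l.
    rewrite /f /dR (dR_same_segment hB0 hB hui (seg_point_seg x0l)).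
    by rewrite seg_point_src// sE AiE.
  split.
  - rewrite /dR (dR_same_segment hB0 hB hui hv) sE -AiE -/t; split=> st.
      by rewrite ger0_norm ?subr_ge0// addrA.
    by rewrite ler0_norm ?subr_le0// opprB -sqrrN opprB addrA.
  - have [lin quad] := cusp_pieces Ai s li.
    have sub_l : `[0, s]%classic `<=` `[0, li]%classic.
      by apply: subset_itvl; rewrite bnd_simp.
    have sub_r : `[s, li]%classic `<=` `[0, li]%classic.
      by apply: subset_itvr; rewrite bnd_simp.
    split=> [/lin[[p [q l]] [p' [q' r]]]
            |/quad[[p [q [c [p0 l]]]] [p' [q' [c' [p0' r]]]]]]; split.
    + by exists p, q => x xs; rewrite -fE ?l// mem_set//; exact: sub_l.
    + by exists p', q' => x xs; rewrite -fE ?r// mem_set//; exact: sub_r.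
    + by exists p, q, c; split=> // x xs; rewrite -fE ?l// mem_set//; exact: sub_l.
    + by exists p', q', c'; split=> // x xs; rewrite -fE ?r// mem_set//; exact: sub_r.
  - apply: subspace_eq_continuous fE _.
    by apply: continuous_subspaceT; exact: cusp_continuous.
  - move=> x xl xs; apply: (differentiable_within_eq fE); first exact: mem_set.
    exact: cusp_differentiable_within.
move=> ij; have dRE y : seg i y -> dR u y =
    Ai * enorm (y - src i) ^+ 2 + Bij * enorm (y - src i) + Cij.
  by move=> iy; rewrite /dR (dR_other_segment hB0 hB ij hu iy) AiE.
have fE x : 0 <= x <= li -> f x = Ai * x ^+ 2 + Bij * x + Cij.
  move=> x0l; rewrite /f dRE; last exact: seg_point_seg.
  by case/andP: x0l => x0 _; rewrite seg_point_src.
split.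
- exact: dRE.
- by apply: (@quadratic_or_linear_on _ _ _ Ai Bij Cij) => x; rewrite /= in_itv; exact: fE.
- exact: concave_quadratic_on fE.
(* The endpoints of L_i correspond to t = 0, where only [Cij] survives, and t = l_i. *)
- have -> : dR u (src i) = Cij.
    by rewrite (dRE _ (src_seg i)) subrr enorm0 expr0n !mulr0 !add0r.
  rewrite (dRE _ hv) (dRE _ (tgt_seg i)) (enormBC (tgt i)) -/(len i) -/li -/t.
  by apply: quadratic_ge_min; rewrite ?t0.
Qed.
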